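(* Let $P$ be a uniformly continuously searchable closeness space with a fixed searcher $\mathcal{E}_P$, let $O$ be a pseudocloseness space, let $M:P\to O$ be uniformly continuous, and let $\Omega\in O$ be synthetically constructed from $M$, i.e. $\Omega=M(k)$ for some $k\in P$. For $\varepsilon\in\mathbb{N}$ define $\mathrm{reg}(\varepsilon,M,\Omega):=\mathcal{E}_P\big(p\mapsto C_\varepsilon(M(p),\Omega)\big)$. Then for every $\varepsilon\in\mathbb{N}$, the regressed oracle $\omega:=M(\mathrm{reg}(\varepsilon,M,\Omega))$ satisfies $C_\varepsilon(\omega,\Omega)$.
   Context: Constructive type theory. $\mathbb{N}_\infty$: decreasing binary sequences; $\underline{n}$: $n$ ones then zeros; $\infty$: all ones; $u\preceq v$ iff $\forall n\,(u_n=1\Rightarrow v_n=1)$; $\min$ pointwise. A closeness space is a type with $c:X\to X\to\mathbb{N}_\infty$ satisfying $c(x,y)=\infty\iff x=y$, symmetry, and $\min(c(x,y),c(y,z))\preceq c(x,z)$; a pseudocloseness space satisfies the same except only $x=y\Rightarrow c(x,y)=\infty$. $C_\varepsilon(x,y)$ means $\underline{\varepsilon}\preceq c(x,y)$. $M$ is uniformly continuous if for each $\varepsilon$ there is $\delta$ with $C_\delta(p_1,p_2)\Rightarrow C_\varepsilon(M(p_1),M(p_2))$. A predicate $p$ on $P$ is decidable if each $p(x)$ is decided, uniformly continuous if there is $\delta$ with $C_\delta(x_1,x_2)\Rightarrow(p(x_1)\Leftrightarrow p(x_2))$. A searcher on $P$ is a function $\mathcal{E}_P$ sending each decidable predicate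 $p$ given with a modulus of uniform continuity to an element $\mathcal{E}_P(p)\in P$ such that if some $x\in P$ satisfies $p$ then $p(\mathcal{E}_P(p))$; $P$ is uniformly continuously searchable if it has a searcher. (The predicate $p\mapsto C_\varepsilon(M(p),\Omega)$ is decidable and uniformly continuous.) *)

(* Defs.v *)
From mathcomp Require Import all_boot.

Set Implicit Arguments.
Unset Strict Implicit.
Unset Printing Implicit Defensive.

(* Existential data that a searcher may consume (moduli of uniform continuity,
   decisions) are stored in Type with {_ | _} and [decidable]; only
   propositions live in Prop. Equality on [Ninf] is Leibniz equality, which
   under functional extensionality coincides with pointwise equality. *)

Record Ninf : Type := MkNinf {
  Ninf_seq :> nat -> bool;
  Ninf_decr : forall n, Ninf_seq n.+1 -> Ninf_seq n
}.

Lemma ltn_decr (m n : nat) : n.+1 < m -> n < m.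
Proof. exact: ltnW. Qed.

Definition underline (m : nat) : Ninf := MkNinf (ltn_decr (m := m)).

Definition Ninfty : Ninf := @MkNinf (fun=> true) (fun _ h => h).

Definition Ninf_le (u v : Ninf) : Prop := forall n, u n -> v n.

Lemma andb_decr (u v : Ninf) (n : nat) : u n.+1 && v n.+1 -> u n && v n.
Proof. by case/andP=> /Ninf_decr -> /Ninf_decr ->. Qed.

Definition Ninf_min (u v : Ninf) : Ninf := MkNinf (andb_decr (u := u) (v := v)).

Record pseudoclosenessSpace : Type := PseudoclosenessSpace {
  carrier :> Type;
  clo : carrier -> carrier -> Ninf;
  clo_refl : forall x y, x = y -> clo x y = Ninfty;
  clo_sym : forall x y, clo x y = clo y x;
  clo_ultra : forall x y z, Ninf_le (Ninf_min (clo x y) (clo y z)) (clo x z)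
}.

Record closenessSpace : Type := ClosenessSpace {
  pseudo :> pseudoclosenessSpace;
  clo_eq : forall x y : pseudo, clo x y = Ninfty <-> x = y
}.

Definition close (X : pseudoclosenessSpace) (eps : nat) (x y : X) : Prop :=
  Ninf_le (underline eps) (clo x y).

Definition unif_continuous (X Y : pseudoclosenessSpace) (f : X -> Y) : Type :=
  forall eps : nat, {delta : nat |
    forall x1 x2 : X, close delta x1 x2 -> close eps (f x1) (f x2)}.

Definition unif_continuous_pred (X : pseudoclosenessSpace) (p : X -> Prop) :
  Type :=
  {delta : nat | forall x1 x2 : X, close delta x1 x2 -> (p x1 <-> p x2)}.

Record ducPred (X : pseudoclosenessSpace) : Type := DucPred {
  ducp :> X -> Prop;
  ducp_dec : forall x, decidable (ducp x);
  ducp_uc : unif_continuous_pred ducp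
}.

Record searcher (X : closenessSpace) : Type := Searcher {
  search :> ducPred X -> X;
  searchP : forall p : ducPred X, (exists x, p x) -> p (search p)
}.

Lemma closeP (X : pseudoclosenessSpace) (eps : nat) (x y : X) :
  reflect (close eps x y) (all (clo x y) (iota 0 eps)).
Proof.
by apply: (iffP allP) => h n; have := h n; rewrite mem_iota add0n.
Qed.

Definition close_dec (X : pseudoclosenessSpace) (eps : nat) (x y : X) :
  decidable (close eps x y) := decP (closeP eps x y).

Lemma close_sym (X : pseudoclosenessSpace) (eps : nat) (x y : X) :
  close eps x y -> close eps y x.
Proof. by rewrite /close clo_sym. Qed.

Lemma close_trans (X : pseudoclosenessSpace) (eps : nat) (x y z : X) :
  close eps x y -> close eps y z -> close eps x z.
Proof.
by move=> xy yz n hn; apply: (@clo_ultra X x y z); rewrite /= xy ?yz.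
Qed.

Lemma close_iff (X : pseudoclosenessSpace) (eps : nat) (x y z : X) :
  close eps x y -> (close eps x z <-> close eps y z).
Proof.
by move=> xy; split; apply: close_trans => //; apply: close_sym.
Qed.

Definition close_to_oracle_uc (P O : pseudoclosenessSpace) (M : P -> O)
    (Muc : unif_continuous M) (eps : nat) (Omega : O) :
  unif_continuous_pred (fun p : P => close eps (M p) Omega) :=
  let: exist delta h := Muc eps in
  exist _ delta (fun p1 p2 h12 => close_iff Omega (h p1 p2 h12)).

Definition close_to_oracle (P O : pseudoclosenessSpace) (M : P -> O)
    (Muc : unif_continuous M) (eps : nat) (Omega : O) : ducPred P :=
  {| ducp := fun p : P => close eps (M p) Omega;
     ducp_dec := fun p => close_dec eps (M p) Omega;
     ducp_uc := close_to_oracle_uc Muc eps Omega |}.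

Definition reg (P : closenessSpace) (E : searcher P)
    (O : pseudoclosenessSpace) (eps : nat) (M : P -> O)
    (Muc : unif_continuous M) (Omega : O) : P :=
  E (close_to_oracle Muc eps Omega).

(* Main.v *)
Require Import Defs.
From mathcomp Require Import all_boot.

Theorem theorem4p36 (P : closenessSpace) (E : searcher P)
    (O : pseudoclosenessSpace) (M : P -> O) (Muc : unif_continuous M)
    (Omega : O) (hOmega : exists k : P, Omega = M k) (eps : nat) :
  close eps (M (reg E eps Muc Omega)) Omega.
Proof.
(* [reg] unfolds to the point that [E] selects for this predicate, so the searcher's guarantee
   reduces the goal to the existence of some point satisfying it. *)
apply: (searchP E (p := close_to_oracle Muc eps Omega)).
(* The hidden parameter [k] is such a point, at every precision: the bound [n < eps] is
   discarded. *)
case: hOmega => k Omega_k; exists k => n _.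
(* As [M k = Omega], their closeness is [Ninfty], whose digits are all ones. *)
by rewrite /= clo_refl.
Qed.
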